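(* Let $X$ be an ordered Banach space with generating cone and let $Z$ be a Banach lattice. Assume that there exist a positive operator $J \in \mathcal{L}(X,Z)$ and a sequence $(R_n)$ of positive operators in $\mathcal{L}(Z,X)$ such that $(R_nJ) \subseteq \mathcal{L}(X)$ converges to $\operatorname{id}_X$ with respect to the weak operator topology. (a) The space $\operatorname{span}(X'_+) = X'_+ - X'_+$ is a monotonically complete Banach lattice with respect to a norm equivalent to $\|\cdot\|_{\operatorname{span}(X'_+)}$. (b) If $X$ is reflexive, then the Banach lattice $\operatorname{span}(X'_+)$ is a KB-space. (c) If the sequence $(J R_n) \subseteq \mathcal{L}(Z)$ converges to $\operatorname{id}_Z$ with respect to the weak operator topology, then $J'$ is a lattice homomorphism from $Z'$ to $\operatorname{span}(X'_+)$ and $J'Z'$ is a lattice ideal in $\operatorname{span}(X'_+)$.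
   Context: All spaces are real. A cone in a real vector space $X$ is a non-empty set $X_+\subseteq X$ with $\alpha X_+ + \beta X_+ \subseteq X_+$ for all real $\alpha,\beta\ge 0$ and $X_+\cap(-X_+)=\{0\}$; it induces the order $x\le y :\Leftrightarrow y-x\in X_+$. The cone is generating if $X=X_+-X_+$. An ordered Banach space is a Banach space with a norm-closed cone. For an ordered Banach space $X$ one has $\operatorname{span}(X_+)=X_+-X_+$; this space is ordered by the cone $X_+$ and endowed with the complete norm $$\|x\|_{\operatorname{span}(X_+)} := \inf\{\|y\|+\|z\| : y,z\in X_+,\ x=y-z\}.$$ If $\operatorname{span}(X_+)$ is dense in $X$, the dual space $X'$ is an ordered Banach space with the dual cone $X'_+:=\{x'\in X' : \langle x',x\rangle\ge 0 \text{ for all } x\in X_+\}$. A vector lattice is an ordered vector space in which any two elements have a supremum; $|x|:=\sup\{x,-x\}$. A Banach lattice is an ordered Banach space that is a vector lattice such that $|x|\le|y|$ implies $\|x\|\le\|y\|$; its dual is again a Banach lattice. A Banach lattice is monotonically complete if every increasing norm-bounded net in it has a supremum. A KB-space is a Banach lattice in which every increasing norm-bounded net (equivalently, sequence) is norm-convergent. A subspace $I$ of a vector lattice $Z$ is a lattice ideal if $|x|\le|y|$ with $x \in Z$, $y\in I$ implies $x\in I$. $\mathcal{L}(X,Z)$ is the space of bounded linear operators from $X$ to $Z$, $\mathcal{L}(X):=\mathcal{L}(X,X)$; a linear map $T:X\to Z$ is positive if $TX_+\subseteq Z_+$; $J'$ denotes the Banach space adjoint of $J$. *)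

(* Defs.v *)
From HB Require Import structures.
From mathcomp Require Import all_boot all_order all_algebra.
From mathcomp Require Import all_classical all_reals all_analysis.

Set Implicit Arguments.
Unset Strict Implicit.
Unset Printing Implicit Defensive.

Import Order.TTheory GRing.Theory Num.Theory.
Import numFieldNormedType.Exports.

Local Open Scope classical_set_scope.
Local Open Scope ring_scope.

Section ordered_vector_spaces.
Context {R : realType} {V : lmodType R}.
Implicit Types (C E I S : set V) (x y z s : V) (N : V -> R).

Definition is_cone C : Prop :=
  [/\ C !=set0,
      forall (a b : R) x y, 0 <= a -> 0 <= b -> C x -> C y ->
        C (a *: x + b *: y)
    & C `&` [set x | C (- x)] = [set 0] ].

Definition cone_le C x y : Prop := C (y - x).

Definition generating C : Prop :=
  forall x, exists y z, [/\ C y, C z & x = y - z].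

(* Suprema are relative to the order of a cone, hence a relation here rather
   than the supremum of a library order structure. *)
Definition is_sup C S s : Prop :=
  (forall x, S x -> cone_le C x s) /\
  (forall t, (forall x, S x -> cone_le C x t) -> cone_le C s t).

(* [|x| = sup {x, -x}]; the value is 0 when this supremum does not exist. *)
Definition modulus C x : V := xget 0 [set s | is_sup C [set x; - x] s].

Definition vector_lattice C : Prop :=
  is_cone C /\ forall x y, exists s, is_sup C [set x; y] s.

Definition linear_subspace E : Prop :=
  E 0 /\ forall (a : R) x y, E x -> E y -> E (a *: x + y).

Definition lattice_ideal C I : Prop :=
  linear_subspace I /\
  forall x y, cone_le C (modulus C x) (modulus C y) -> I y -> I x.

(* Norms are plain functions [V -> R], so that one vector space can carry
   several of them. For the norm of a [completeNormedModType] the next three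
   definitions agree with the library notions, see [banach_normP] and
   [norm_closedP] below. *)
Definition is_norm N : Prop :=
  [/\ forall x y, N (x + y) <= N x + N y,
      forall (a : R) x, N (a *: x) = `|a| * N x
    & forall x, N x = 0 -> x = 0].

Definition norm_cauchy_complete N : Prop :=
  forall u : nat -> V,
    (forall e : R, 0 < e -> exists n0, forall m n,
       (n0 <= m)%N -> (n0 <= n)%N -> N (u m - u n) < e) ->
    exists l, forall e : R, 0 < e -> exists n0, forall n,
      (n0 <= n)%N -> N (u n - l) < e.

Definition norm_closed N C : Prop :=
  forall x, (forall e : R, 0 < e -> exists2 y, C y & N (x - y) < e) -> C x.

Definition ordered_banach_space N C : Prop :=
  [/\ is_norm N, norm_cauchy_complete N, is_cone C & norm_closed N C].

Definition banach_lattice N C : Prop :=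
  [/\ ordered_banach_space N C, vector_lattice C
    & forall x y, cone_le C (modulus C x) (modulus C y) -> N x <= N y].

Definition equivalent_norms N1 N2 : Prop :=
  exists c d : R, [/\ 0 < c, 0 < d & forall x, c * N1 x <= N2 x <= d * N1 x].

Definition directed (A : Type) (le : A -> A -> Prop) : Prop :=
  [/\ exists i : A, True,
      forall i, le i i,
      forall i j k, le i j -> le j k -> le i k
    & forall i j, exists2 k, le i k & le j k].

Definition increasing_net C (A : Type) (le : A -> A -> Prop) (u : A -> V) :=
  directed le /\ forall i j, le i j -> cone_le C (u i) (u j).

Definition norm_bounded N (A : Type) (u : A -> V) : Prop :=
  exists M : R, forall i, N (u i) <= M.

Definition net_norm_converges N (A : Type) (le : A -> A -> Prop)
    (u : A -> V) (l : V) : Prop :=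
  forall e : R, 0 < e -> exists i0, forall i, le i0 i -> N (u i - l) < e.

Definition monotonically_complete N C : Prop :=
  forall (A : Type) (le : A -> A -> Prop) (u : A -> V),
    increasing_net C le u -> norm_bounded N u ->
    exists s, is_sup C (range u) s.

Definition KB_space N C : Prop :=
  banach_lattice N C /\
  forall (A : Type) (le : A -> A -> Prop) (u : A -> V),
    increasing_net C le u -> norm_bounded N u ->
    exists l, net_norm_converges N le u l.

End ordered_vector_spaces.

Definition positive_map {R : realType} {V W : lmodType R} (C : set V)
    (D : set W) (T : V -> W) : Prop :=
  forall x, C x -> D (T x).

(* [T] is linear and maps the supremum of [x] and [y] to that of [T x] and
   [T y]. *)
Definition lattice_homomorphism {R : realType} {V W : lmodType R}
    (C : set V) (D : set W) (T : V -> W) : Prop :=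
  linear T /\
  forall x y s, is_sup C [set x; y] s -> is_sup D [set T x; T y] (T s).

Section linear_span.
Context {R : realType} {V : lmodType R}.
Variable C : set V.

Definition span_pred : {pred V} := fun x => `[< smallest linear_subspace C x >].

Lemma span_predP x : reflect (smallest linear_subspace C x) (x \in span_pred).
Proof. exact: asboolP. Qed.

Lemma span_pred_closed : submod_closed span_pred.
Proof.
split=> [|a x y /span_predP Cx /span_predP Cy].
  by apply/span_predP => E [[]].
by apply/span_predP => E [sE CE]; apply: sE.2; [exact: Cx|exact: Cy].
Qed.

HB.instance Definition _ :=
  GRing.isSubmodClosed.Build R V span_pred
    (GRing.submod_closed_semi span_pred_closed).

Record span_of := Span { span_val :> V; _ : span_val \in span_pred }.

HB.instance Definition _ := [isSub for span_val].
HB.instance Definition _ := [Choice of span_of by <:].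
HB.instance Definition _ := [SubChoice_isSubLmodule of span_of by <:].

Definition span_cone : set span_of := [set x | C (span_val x)].

End linear_span.
Arguments span_cone {R V} C.

(* The infimum is over a non-empty set as soon as [x] lies in [C - C]; outside
   this set the value is meaningless. *)
Definition span_norm {R : realType} {V : normedModType R} (C : set V)
    (x : span_of C) : R :=
  inf [set r | exists y z, [/\ C y, C z, span_val x = y - z & r = `|y| + `|z|]].
Arguments span_norm {R V} C x.

Section bounded_operators.
Context {R : realType} (V W : normedModType R).

Definition bop_pred : {pred V -> W} :=
  fun f => `[< linear f /\ continuous f >].

Lemma bop_predP f : reflect (linear f /\ continuous f) (f \in bop_pred).
Proof. exact: asboolP. Qed.

Lemma bop_pred_closed : submod_closed bop_pred.
Proof.
split=> [|a f g /bop_predP[lf cf] /bop_predP[lg cg]]; apply/bop_predP; split.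
- by move=> a x y; rewrite [LHS]/= scaler0 addr0.
- by move=> x; exact: cvg_cst.
- move=> b x y; have fgE u : (a *: f + g) u = a *: f u + g u by [].
  by rewrite !fgE lf lg !scalerDr !scalerA (mulrC a b) addrACA.
- by move=> x; apply: cvgD; [apply: cvgZr; exact: cf|exact: cg].
Qed.

HB.instance Definition _ :=
  GRing.isSubmodClosed.Build R (V -> W) bop_pred
    (GRing.submod_closed_semi bop_pred_closed).

Record bop := Bop { bop_fun :> V -> W; _ : bop_fun \in bop_pred }.

HB.instance Definition _ := [isSub for bop_fun].
HB.instance Definition _ := [Choice of bop by <:].
HB.instance Definition _ := [SubChoice_isSubLmodule of bop by <:].

Lemma bop_linear (f : bop) : linear f.
Proof. by have /bop_predP[] := valP f. Qed.

Lemma bop_continuous (f : bop) : continuous f.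
Proof. by have /bop_predP[] := valP f. Qed.

HB.instance Definition _ (f : bop) :=
  GRing.isLinear.Build R V W *:%R f (bop_linear f).

Definition mk_bop (f : V -> W) (lf : linear f) (cf : continuous f) : bop :=
  Bop (introT (bop_predP f) (conj lf cf)).

Definition op_norm (f : bop) : R := sup [set `|f x| | x in [set x | `|x| <= 1]].

Lemma op_norm_has_sup (f : bop) :
  has_sup [set `|f x| | x in [set x | `|x| <= 1]].
Proof.
split; first by exists `|f 0|, 0 => //=; rewrite normr0.
have /linear_bounded_continuous/bounded_funP/(_ 1)[M fM] := @bop_continuous f.
by exists M => _ [x x1 <-]; exact: fM.
Qed.

Lemma op_norm_ub (f : bop) x : `|x| <= 1 -> `|f x| <= op_norm f.
Proof. by move=> x1; apply: sup_upper_bound (op_norm_has_sup f) _ _; exists x. Qed.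

Lemma op_norm_le (f : bop) (M : R) :
  (forall x, `|x| <= 1 -> `|f x| <= M) -> op_norm f <= M.
Proof.
move=> fM; apply: ge_sup; first by have [] := op_norm_has_sup f.
by move=> _ [x x1 <-]; exact: fM.
Qed.

Lemma op_norm_ge0 (f : bop) : 0 <= op_norm f.
Proof. by apply: le_trans (@op_norm_ub f 0 _); rewrite ?normr0. Qed.

Lemma op_normD (f g : bop) : op_norm (f + g) <= op_norm f + op_norm g.
Proof.
apply: op_norm_le => x x1; apply: le_trans (ler_normD _ _) _.
by apply: lerD; exact: op_norm_ub.
Qed.

Lemma op_normZ (a : R) (f : bop) : op_norm (a *: f) = `|a| * op_norm f.
Proof.
have le b g : op_norm (b *: g) <= `|b| * op_norm g.
  apply: op_norm_le => x x1; rewrite [X in `|X|](_ : _ = b *: g x)//.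
  by rewrite normrZ ler_wpM2l//; exact: op_norm_ub.
apply/eqP; rewrite eq_le le/=.
have [->|a0] := eqVneq a 0; first by rewrite normr0 mul0r op_norm_ge0.
rewrite -ler_pdivlMl ?normr_gt0// -normfV.
by rewrite -{1}(scale1r f) -(mulVf a0) -scalerA; exact: le.
Qed.

Lemma op_norm_eq0 (f : bop) : op_norm f = 0 -> f = 0.
Proof.
move=> f0; apply: val_inj; apply/funext => x /=.
have [->|x0] := eqVneq x 0; first exact: linear0.
have nx0 : `|x| != 0 by rewrite normr_eq0.
have : `|f (`|x|^-1 *: x)| <= 0.
  by rewrite -f0 op_norm_ub// normrZ normfV normr_id mulVf.
rewrite normr_le0 linearZ/= scaler_eq0 invr_eq0 (negbTE nx0)/=.
by move/eqP.
Qed.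

HB.instance Definition _ :=
  Lmodule_isNormed.Build R bop op_normD op_normZ op_norm_eq0.

End bounded_operators.

Section dual.
Context {R : realType}.

Definition dual (V : normedModType R) := bop V R.

Definition dual_cone (V : normedModType R) (C : set V) : set (dual V) :=
  [set f : dual V | forall x, C x -> 0 <= f x].

(* Surjectivity of the canonical embedding into the bidual. *)
Definition reflexive_space (V : normedModType R) : Prop :=
  forall phi : dual (dual V), exists x : V, forall f : dual V, phi f = f x.

Lemma id_linear (V : normedModType R) : linear (@idfun V).
Proof. by []. Qed.

Lemma id_continuous (V : normedModType R) : continuous (@idfun V).
Proof. by move=> x; exact: cvg_id. Qed.

Definition bop_id (V : normedModType R) : bop V V :=
  mk_bop (@id_linear V) (@id_continuous V).

Section comp.
Variables (U V W : normedModType R) (g : bop V W) (f : bop U V).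

Lemma comp_linear : linear (g \o f).
Proof. by move=> a x y; rewrite /= !linearP. Qed.

Lemma comp_continuous : continuous (g \o f).
Proof.
by move=> x; apply: continuous_comp; exact: bop_continuous.
Qed.

Definition bop_comp : bop U W := mk_bop comp_linear comp_continuous.

End comp.

Definition adjoint (V W : normedModType R) (T : bop V W) (f : dual W) :
  dual V := bop_comp f T.

Definition wot_converges (V W : normedModType R) (T : nat -> bop V W)
    (T0 : bop V W) : Prop :=
  forall (x : V) (f : dual W), (fun n => f (T n x)) @ \oo --> f (T0 x).

End dual.

Section library_agreement.
Context {R : realType}.

Lemma banach_normP (V : completeNormedModType R) :
  is_norm (@Num.norm R V) /\ norm_cauchy_complete (@Num.norm R V).
Proof.
split; first by split; [exact: ler_normD|exact: normrZ|exact: normr0_eq0].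
move=> u cu; have /cauchy_cvgP/cvg_ex[l ul] : cauchy (u @ \oo).
  apply/cauchy_ballP => e e0; have [n0 H] := cu _ e0.
  exists ([set u n | n in [set n | (n0 <= n)%N]],
          [set u n | n in [set n | (n0 <= n)%N]]) => /=.
    by split; exists n0 => // n /= ?; exists n.
  by move=> [_ _] [/= [m m0 <-] [n nn0 <-]]; rewrite -ball_normE; exact: H.
exists l => e e0; have /cvgrPdist_lt/(_ _ e0)[n0 _ H] := ul.
by exists n0 => n nn0; rewrite distrC; exact: H.
Qed.

Lemma norm_closedP (V : normedModType R) (C : set V) :
  norm_closed (@Num.norm R V) C <-> closed C.
Proof.
split=> [cC x xC|cC x xC].
  apply: cC => e e0; have [y [Cy]] := xC _ (nbhsx_ballx x e e0).
  by rewrite -ball_normE; exists y.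
apply: cC => B /nbhs_ballP[e /= e0 xB]; have [y Cy xy] := xC _ e0.
by exists y; split=> //; apply: xB; rewrite -ball_normE.
Qed.

End library_agreement.

(* Main.v *)
(* The main tool is the pointwise limit of a family of functionals along an
   ultrafilter, which is bounded by the uniform boundedness principle. The
   supremum of u and v in the span of the dual cone is the limit of s_n o J,
   where s_n is the supremum of u o R_n and v o R_n in Z', given by the
   Riesz-Kantorovich formula: an upper bound t of u and v satisfies
   s_n o J <= t o R_n o J on the cone, and t o R_n o J tends to t. Completeness
   and suprema of increasing nets come from the same kind of limit. For (b), a
   decreasing net tending to 0 pointwise tends to 0 uniformly on the positive
   part of the (weakly compact) unit ball of X. For (c), if |u| <= h o J, then
   u o R_n has a limit k on Z, and k o J = u. *)

Require Import Defs.
From HB Require Import structures.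
From mathcomp Require Import all_boot all_order all_algebra.
From mathcomp Require Import all_classical all_reals all_analysis.
From mathcomp Require Import lra.

Set Implicit Arguments.
Unset Strict Implicit.
Unset Printing Implicit Defensive.

Import Order.TTheory GRing.Theory Num.Theory.
Import numFieldNormedType.Exports.

Local Open Scope classical_set_scope.
Local Open Scope ring_scope.

(** * Pointwise evaluation of bounded operators *)

Lemma bopDE (R : realType) (V W : normedModType R) (f g : bop V W) x :
  (f + g) x = f x + g x.
Proof. by []. Qed.

Lemma bopNE (R : realType) (V W : normedModType R) (f : bop V W) x :
  (- f) x = - f x.
Proof. by []. Qed.

Lemma bopBE (R : realType) (V W : normedModType R) (f g : bop V W) x :
  (f - g) x = f x - g x.
Proof. by []. Qed.

Lemma bopZE (R : realType) (V W : normedModType R) a (f : bop V W) x :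
  (a *: f) x = a *: f x.
Proof. by []. Qed.

Lemma bop_ext (R : realType) (V W : normedModType R) (f g : bop V W) :
  (forall x, f x = g x) -> f = g.
Proof. by move=> fg; apply: val_inj; apply/funext. Qed.

(** * Weak-star limits of functionals along ultrafilters *)

Section dual_limits.
Context {R : realType}.

Lemma op_norm_bound (V W : normedModType R) (f : bop V W) x :
  `|f x| <= op_norm f * `|x|.
Proof.
have [->|x0] := eqVneq x 0; first by rewrite linear0 !normr0 mulr0.
have nx : 0 < `|x| by rewrite normr_gt0.
have <- : `|f (`|x|^-1 *: x)| * `|x| = `|f x|.
  by rewrite linearZ normrZ normfV normr_id mulrAC mulVf ?mul1r// gt_eqF.
rewrite ler_wpM2r//.
by rewrite op_norm_ub// normrZ normfV normr_id mulVf// gt_eqF.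
Qed.

Lemma bounded_linear_bop (V W : normedModType R) (f : V -> W) K :
  linear f -> (forall x, `|f x| <= K * `|x|) ->
  exists g : bop V W, forall x, g x = f x.
Proof.
move=> lf fK.
pose F : {linear V -> W} := HB.pack f (GRing.isLinear.Build _ _ _ _ _ lf).
suff cf : continuous f by exists (mk_bop lf cf).
apply: (@bounded_linear_continuous _ _ _ F); apply/bounded_funP => r.
(* The sign of [K] is not known, hence the absolute value. *)
exists (`|K| * r) => x xr; apply: (le_trans (fK x)).
by apply: (@le_trans _ _ (`|K| * `|x|));
  [rewrite ler_wpM2r// ler_norm|rewrite ler_wpM2l].
Qed.

Lemma le_limit (T : Type) (F : set_system T) {FF : ProperFilter F}
    (f g : T -> R) (a b : R) : f @ F --> a -> g @ F --> b ->
  (\forall i \near F, f i <= g i) -> a <= b.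
Proof.
move=> fa gb fg; rewrite -subr_ge0; apply: (cvgr_to_ge (cvgB gb fa)).
by apply: filterS fg => i; rewrite -subr_ge0.
Qed.

(** Compactness of the segment from [- M] to [M] gives a cluster point of the image of [U], and an
    ultrafilter converges to each of its cluster points. *)
Lemma ultrafilter_bounded_cvg (A : Type) (U : set_system A)
    {UF : UltraFilter U} (u : A -> R) M :
  (\forall i \near U, `|u i| <= M) -> exists l : R, u @ U --> l.
Proof.
move=> uM.
have uU : (u @ U) `[- M, M]%classic.
  by apply: filterS uM => i; rewrite /= in_itv/= -ler_norml.
have [l [_ lU]] := segment_compact _ uU.
exists l => B Bl; have [//|UB] := in_ultra_setVsetC (u @^-1` B) UF.
by have [x [nB /nB]] := lU (~` B) B UB Bl.
Qed.

(** Weak-star compactness of balls in the form used below: scalar limits exist at each point, and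
    linearity and the bound [K] pass to the limit. *)
Lemma bounded_ultralimit (V : normedModType R) (A : Type)
    (U : set_system A) {UF : UltraFilter U} (g : A -> dual V) K :
  (\forall i \near U, forall x, `|g i x| <= K * `|x|) ->
  exists f : dual V, forall x, g i x @[i --> U] --> f x.
Proof.
move=> gK.
have /choice[f gf] x : exists l : R, g i x @[i --> U] --> l.
  by apply: (@ultrafilter_bounded_cvg _ U _ _ (K * `|x|)); apply: filterS gK.
have lf : linear f.
  move=> a x y; apply: (@cvg_unique _ (@Rhausdorff R)) (gf (a *: x + y)) _.
  rewrite /= (_ : (fun i => _) = fun i => a *: g i x + g i y); last first.
    by apply/funext => i; rewrite linearP.
  by apply: cvgD; [apply: cvgZr; exact: gf|exact: gf].
have [|h hf] := @bounded_linear_bop V R f K lf.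
  move=> x; by apply: (cvgr_to_le (cvg_norm (gf x))); apply: filterS gK.
by exists h => x; rewrite hf; exact: gf.
Qed.

(** This is the uniform boundedness principle, with the bound on the unit ball turned into an
    operator bound. *)
Lemma pointwise_bounded_dual (V : completeNormedModType R) (A : Type)
    (g : A -> dual V) :
  (forall x, exists M, forall i, `|g i x| <= M) ->
  exists K, forall i x, `|g i x| <= K * `|x|.
Proof.
move=> gb.
pose G := [set (g i : V -> R) | i in setT].
have [|x|K gK] := @Banach_Steinhauss R V R G _ _ 1.
- move=> _ [i _ <-]; split; last exact: bop_linear.
  move=> r; exists (op_norm (g i) * `|r|) => x xr.
  apply: (le_trans (op_norm_bound _ _)); rewrite ler_wpM2l ?op_norm_ge0//.
  exact: le_trans xr (ler_norm _).
- have [M gM] := gb x; exists M => _ [i _ <-]; exact: gM.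
exists K => i x; apply: (le_trans (op_norm_bound _ _)); rewrite ler_wpM2r//.
apply: op_norm_le => y; apply: gK; by exists i.
Qed.

Lemma pointwise_bounded_ultralimit (V : completeNormedModType R) (A : Type)
    (U : set_system A) {UF : UltraFilter U} (g : A -> dual V) :
  (forall x, exists M, forall i, `|g i x| <= M) ->
  exists f : dual V, forall x, g i x @[i --> U] --> f x.
Proof.
move=> /pointwise_bounded_dual[K gK].
by apply: (@bounded_ultralimit _ _ _ _ _ K); exact: nearW.
Qed.

Lemma cvg_seq_norm_bounded (u : nat -> R) (l : R) :
  u @ \oo --> l -> exists M, forall n, `|u n| <= M.
Proof.
move=> ul; have /cvg_seq_bounded/pinfty_ex_gt0[M _ uM] : cvgn u.
  by apply/cvg_ex; exists l.
by exists M => n; exact: uM.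
Qed.

End dual_limits.

(** * Suprema and moduli in ordered vector spaces *)

Section cones.
Context {R : realType} {V : lmodType R} (C : set V).
Hypothesis cC : is_cone C.
Implicit Types x y s t : V.

Lemma coneD x y : C x -> C y -> C (x + y).
Proof.
case: cC => _ cD _ Cx Cy.
by have := cD 1 1 x y ler01 ler01 Cx Cy; rewrite !scale1r.
Qed.

Lemma coneZ (a : R) x : 0 <= a -> C x -> C (a *: x).
Proof.
case: cC => _ cD _ a0 Cx; have := cD a 0 x x a0 (lexx _) Cx Cx.
by rewrite scale0r addr0.
Qed.

Lemma cone0 : C 0.
Proof.
by case: cC => [[x Cx] _ _]; have := coneZ (lexx 0) Cx; rewrite scale0r.
Qed.

Lemma cone_anti x y : C (y - x) -> C (x - y) -> x = y.
Proof.
case: cC => _ _ C0 Cyx Cxy; apply/eqP; rewrite -subr_eq0; apply/eqP.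
suff : [set 0] (x - y) by [].
by rewrite -C0; split => //=; rewrite opprB.
Qed.

Lemma sup_pair_ub x y s : is_sup C [set x; y] s -> C (s - x) /\ C (s - y).
Proof. by case=> ub _; split; apply: ub; [left|right]. Qed.

Lemma sup_pair_least x y s t :
  is_sup C [set x; y] s -> C (t - x) -> C (t - y) -> C (t - s).
Proof. by case=> _ lub tx ty; apply: lub => _ [] ->. Qed.

Lemma sup_pairP x y s : C (s - x) -> C (s - y) ->
  (forall t, C (t - x) -> C (t - y) -> C (t - s)) -> is_sup C [set x; y] s.
Proof.
move=> sx sy least; split=> [_ [] -> //|t ub].
by apply: least; apply: ub; [left|right].
Qed.

Lemma is_sup_unique (S : set V) s t : is_sup C S s -> is_sup C S t -> s = t.
Proof.
by move=> [sub sl] [tub tl]; apply: cone_anti; [exact: sl|exact: tl].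
Qed.

(** [t] is half the sum of [t - x] and [t + x]. *)
Lemma abs_bound_ge0 x t : C (t - x) -> C (t + x) -> C t.
Proof.
move=> tx tNx; rewrite -[t](scale1r) -(mulVf (x := 2 : R))// -scalerA.
apply: coneZ; first by rewrite invr_ge0.
by rewrite scaler_nat mulr2n -{1}(subrK x t) -addrA [x + t]addrC; exact: coneD.
Qed.

Hypothesis lC : vector_lattice C.

Lemma modulusP x : is_sup C [set x; - x] (modulus C x).
Proof. by apply: xgetPex; exact: lC.2. Qed.

Lemma modulus_ge x : C (modulus C x - x) /\ C (modulus C x + x).
Proof. by have := sup_pair_ub (modulusP x); rewrite opprK. Qed.

Lemma modulus_le x t : C (t - x) -> C (t + x) -> C (t - modulus C x).
Proof.
by move=> tx tNx; apply: (sup_pair_least (modulusP x)); rewrite ?opprK.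
Qed.

Lemma modulus_ge0 x : C (modulus C x).
Proof. by have [] := modulus_ge x; exact: abs_bound_ge0. Qed.

Lemma modulus_pos x : C x -> modulus C x = x.
Proof.
move=> Cx; apply: cone_anti; last by have [] := modulus_ge x.
by apply: modulus_le; [rewrite subrr; exact: cone0|exact: coneD].
Qed.

Lemma riesz_decomposition x y a : C x -> C y -> C a -> C (x + y - a) ->
  exists b, [/\ C b, C (x - b), C (a - b) & C (y - (a - b))].
Proof.
move=> Cx Cy Ca Cxya; have [s ss] := lC.2 a x.
have [sa sx] := sup_pair_ub ss.
have abE : a - (a + x - s) = s - x by rewrite opprB opprD addrCA addNKr.
(* This witness is the infimum of [a] and [x]. *)
exists (a + x - s); rewrite abE; split => //.
- by apply: (sup_pair_least ss); rewrite ?addrK// [a + x]addrC addrK.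
- by rewrite opprB [a + x]addrC opprD addrCA addNKr.
- rewrite opprB addrA [y + x]addrC; apply: (sup_pair_least ss) => //.
  by rewrite [x + y]addrC addrK.
Qed.

End cones.

(** * Extension of additive functionals; suprema in the dual of a Banach lattice *)

Section positive_part.
Context {R : realType}.

(** Each [z] is the difference of the cone elements [p z] and [p z - z], so the extension is forced
    to be [r (p z) - r (p z - z)]; the norm control on [p z] makes it bounded. *)
Lemma additive_extension (V : normedModType R) (C : set V) (r : V -> R) K :
  is_cone C ->
  (forall z, exists p, [/\ C p, C (p - z) & `|p| <= `|z| ]) ->
  (forall x y, C x -> C y -> r (x + y) = r x + r y) ->
  (forall (a : R) x, 0 < a -> C x -> r (a *: x) = a * r x) ->
  (forall x, C x -> 0 <= r x <= K * `|x|) ->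
  exists f : dual V, forall x, C x -> f x = r x.
Proof.
move=> cC /choice[p pP] rD rZ rK; pose S z := r (p z) - r (p z - z).
(* The value does not depend on the decomposition: two decompositions of one vector, summed
   crosswise, give the same cone element. *)
have SE a b : C a -> C b -> S (a - b) = r a - r b.
  move=> Ca Cb; rewrite /S; have [Cp Cq _] := pP (a - b).
  have : r (p (a - b) + b) = r ((p (a - b) - (a - b)) + a).
    by congr r; rewrite opprB addrA subrK.
  by rewrite rD// rD// => ?; lra.
have r0 : r 0 = 0.
  by have := rD 0 0 (cone0 cC) (cone0 cC); rewrite addr0 => ?; lra.
have rZ0 (a : R) x : 0 <= a -> C x -> r (a *: x) = a * r x.
  rewrite le_eqVlt => /predU1P[<- _|]; first by rewrite scale0r r0 mul0r.
  exact: rZ.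
have split z : z = p z - (p z - z) by rewrite opprB addrC subrK.
have SD x y : S (x + y) = S x + S y.
  have [Cpx Cqx _] := pP x; have [Cpy Cqy _] := pP y.
  rewrite {1}[x]split {1}[y]split addrACA -opprD SE; try exact: coneD.
  by rewrite rD// rD// /S; lra.
have SZ (a : R) x : S (a *: x) = a * S x.
  have [Cpx Cqx _] := pP x; have [a0|a0] := leP 0 a.
    rewrite {1}[x]split scalerBr SE; try exact: coneZ.
    by rewrite !rZ0// /S; lra.
  have Na0 : 0 <= - a by rewrite oppr_ge0 ltW.
  rewrite {1}[x]split -[a]opprK scaleNr -scalerN opprB scalerBr SE;
    try exact: coneZ.
  by rewrite !rZ0// /S; lra.
have lS : linear S by move=> a x y; rewrite SD SZ.
(* The factor 3 is 1 for [p x] plus 2 for [p x - x]. *)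
have [|f fE] := @bounded_linear_bop R V R S (3 * `|K|) lS.
  move=> x; have [Cp Cq pn] := pP x.
  have /andP[rp0 rp] := rK _ Cp; have /andP[rq0 rq] := rK _ Cq.
  have K0 := ler_norm K; have K0' : 0 <= `|K| := normr_ge0 _.
  have qn : `|p x - x| <= 2 * `|x|.
    by apply: (le_trans (ler_normB _ _)); lra.
  have n0 := normr_ge0 (p x); have m0 := normr_ge0 (p x - x).
  have rp' : r (p x) <= `|K| * `|x| by nra.
  have rq' : r (p x - x) <= `|K| * (2 * `|x|) by nra.
  apply: (le_trans (ler_normB _ _)).
  by rewrite (ger0_norm rp0) (ger0_norm rq0); lra.
exists f => x Cx; rewrite fE -[x in LHS]subr0 SE//; last exact: cone0.
by rewrite r0 subr0.
Qed.

Context {Z : completeNormedModType R} {C : set Z}.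
Hypothesis blC : banach_lattice (@Num.norm R Z) C.

Let cC : is_cone C. Proof. by case: blC => _ []. Qed.
Let lC : vector_lattice C. Proof. by case: blC. Qed.

Lemma banach_lattice_monotone x y : C x -> C (y - x) -> `|x| <= `|y|.
Proof.
move=> Cx Cyx; have Cy : C y by have := coneD cC Cyx Cx; rewrite subrK.
by case: blC => _ _; apply; rewrite /cone_le !modulus_pos.
Qed.

Lemma modulus_norm x : `|modulus C x| = `|x|.
Proof.
have CC : cone_le C (modulus C x) (modulus C x).
  by rewrite /cone_le subrr; exact: cone0.
apply/eqP; rewrite eq_le; case: blC => _ _ mono.
by apply/andP; split; apply: mono;
  rewrite [modulus C (modulus C _)]modulus_pos//; exact: modulus_ge0.
Qed.

(* Riesz-Kantorovich formula for the positive part of [f]. *)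
Lemma dual_positive_part (f : dual Z) : exists g : dual Z, forall y, C y ->
  (forall a, C a -> C (y - a) -> f a <= g y) /\
  (forall c, (forall a, C a -> C (y - a) -> f a <= c) -> g y <= c).
Proof.
pose E y := [set f a | a in [set a | C a /\ C (y - a)]].
have ubE y : C y -> ubound (E y) (op_norm f * `|y|).
  move=> Cy _ [a [Ca Cya] <-]; apply: (le_trans (ler_norm _)).
  apply: (le_trans (op_norm_bound _ _)); rewrite ler_wpM2l ?op_norm_ge0//.
  exact: banach_lattice_monotone.
have ne y : C y -> E y !=set0.
  by move=> Cy; exists (f 0), 0 => //; split; rewrite ?subr0//; exact: cone0.
pose r y := sup (E y).
have rub y a : C y -> C a -> C (y - a) -> f a <= r y.
  move=> Cy Ca Cya; apply: ub_le_sup; last by exists a.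
  by exists (op_norm f * `|y|); exact: ubE.
have rle y c : C y -> (forall a, C a -> C (y - a) -> f a <= c) -> r y <= c.
  by move=> Cy fc; apply: ge_sup (ne y Cy) _ => _ [a [Ca Cya] <-]; exact: fc.
have [||||g gE] := @additive_extension Z C r (op_norm f) cC.
- move=> z; exists (modulus C z); rewrite modulus_norm; split => //.
    exact: modulus_ge0.
  by have [] := modulus_ge lC z.
- move=> x y Cx Cy; apply/eqP; rewrite eq_le; apply/andP; split.
    (* Subadditivity: an element [a] below [x + y] splits into a part below [x] and a part below
       [y]. *)
    apply: rle => [|a Ca Cxya]; first exact: coneD.
    have [b [Cb Cxb Cab Cyab]] := riesz_decomposition lC Cx Cy Ca Cxya.
    by rewrite -[a](subrK b) addrC linearD; apply: lerD; exact: rub.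
  rewrite -lerBrDr; apply: (rle) => // a Ca Cxa.
  rewrite lerBrDr addrC -lerBrDr; apply: rle => // b Cb Cyb.
  rewrite lerBrDr -linearD; apply: rub; [exact: coneD|exact: coneD|].
  by rewrite [b + a]addrC opprD addrACA; exact: coneD.
(* One inequality suffices: applied to [a^-1] and [a *: x] it yields the other. *)
- have le (a : R) x : 0 < a -> C x -> r (a *: x) <= a * r x.
    move=> a0 Cx; apply: rle => [|b Cb Caxb].
      by apply: coneZ => //; exact: ltW.
    have ai : 0 <= a^-1 by rewrite invr_ge0 ltW.
    have -> : b = a *: (a^-1 *: b) by rewrite scalerA mulfV ?scale1r ?gt_eqF.
    rewrite linearZ ler_wpM2l ?(ltW a0)//; apply: rub => //; first exact: coneZ.
    have := coneZ cC ai Caxb.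
    by rewrite scalerBr scalerA mulVf ?scale1r ?gt_eqF.
  move=> a x a0 Cx; apply/eqP; rewrite eq_le le//=.
  have ai : 0 < a^-1 by rewrite invr_gt0.
  have Cax : C (a *: x) by apply: coneZ => //; exact: ltW.
  have := le _ _ ai Cax; rewrite scalerA mulVf ?gt_eqF// scale1r.
  by rewrite ler_pdivlMl.
- move=> x Cx; apply/andP; split.
    by rewrite -(linear0 f); apply: rub; rewrite ?subr0//; exact: cone0.
  by apply: rle => // a Ca Cxa; apply: (ubE x Cx); exists a.
exists g => y Cy; rewrite gE//; split=> [a|c]; [exact: rub|exact: rle].
Qed.

(** The supremum of [f] and [g] is the positive part of [f - g], plus [g]. *)
Lemma dual_sup (f g : dual Z) : exists s : dual Z, forall y, C y ->
  (forall a, C a -> C (y - a) -> f a + g (y - a) <= s y) /\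
  (forall c, (forall a, C a -> C (y - a) -> f a + g (y - a) <= c) -> s y <= c).
Proof.
have [h hP] := dual_positive_part (f - g); exists (h + g) => y Cy.
have [hub hle] := hP y Cy; rewrite bopDE; split => [a Ca Cya|c fgc].
  by have := hub a Ca Cya; rewrite bopBE linearB => ?; lra.
rewrite -lerBrDr; apply: hle => a Ca Cya.
by have := fgc a Ca Cya; rewrite bopBE linearB => ?; lra.
Qed.

End positive_part.

(** * The span of the dual of a generating cone *)

Lemma cone_smallest_subspace (R : realType) (V : lmodType R) (C : set V) :
  is_cone C ->
  smallest linear_subspace C
    = [set f | exists g h, [/\ C g, C h & f = g - h]].
Proof.
move=> cC; apply/seteqP; split => [|_ [g [h [Cg Ch ->]]] E [sE CE]].
  apply: smallest_sub => [|x Cx]; last first.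
    by exists x, 0; split => //; [exact: cone0|rewrite subr0].
  split=> [|a _ _ [x [y [Cx Cy ->]]] [z [t [Cz Ct ->]]]].
    by exists 0, 0; split; rewrite ?subrr//; exact: cone0.
  have [a0|a0] := leP 0 a.
    exists (a *: x + z), (a *: y + t); split; last first.
    - by rewrite scalerBr addrACA opprD.
    - by apply: coneD => //; exact: coneZ.
    - by apply: coneD => //; exact: coneZ.
  (* A negative scalar exchanges the two parts of the decomposition. *)
  have Na0 : 0 <= - a by rewrite oppr_ge0 ltW.
  exists ((- a) *: y + z), ((- a) *: x + t); split; last first.
  - by rewrite opprD addrACA -scalerBr scaleNr -scalerN opprB.
  - by apply: coneD => //; exact: coneZ.
  - by apply: coneD => //; exact: coneZ.
(* This brings [g - h] into the form [-1 *: h + 1 *: g], to which closure of the subspace [E]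
   applies. *)
rewrite -[g - h]add0r addrC -[g]scale1r addrC addrA add0r addrC -scaleN1r.
by apply: sE.2; [exact: CE|rewrite scale1r; exact: CE].
Qed.

Section dual_of_generating_cone.
Context {R : realType} {X : completeNormedModType R} {Xp : set X}.
Hypothesis genX : generating Xp.
Local Notation Xp' := (dual_cone Xp).
Local Notation S := (span_of Xp').
Implicit Types (f g h : dual X) (u v w : S) (x y z : X).

Lemma dual_ext f g : (forall x, Xp x -> f x = g x) -> f = g.
Proof.
move=> fg; apply: bop_ext => x; have [y [z [Xy Xz ->]]] := genX x.
by rewrite !linearB/= !fg.
Qed.

Lemma dual_cone_is_cone : is_cone Xp'.
Proof.
split; first by exists 0.
  move=> a b f g a0 b0 f0 g0 x Xx; rewrite bopDE !bopZE.
  by apply: addr_ge0; apply: mulr_ge0; auto.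
apply/seteqP; split => [f [f0 Nf0]|_ ->]; last first.
  by split=> x Xx; rewrite ?bopNE ?oppr0.
apply: dual_ext => x Xx; apply/eqP; rewrite eq_le f0// andbT.
by have := Nf0 x Xx; rewrite bopNE oppr_ge0.
Qed.

Lemma spanD u v x : span_val (u + v) x = span_val u x + span_val v x.
Proof. by rewrite (raddfD val u v : span_val (u + v) = _). Qed.

Lemma spanB u v x : span_val (u - v) x = span_val u x - span_val v x.
Proof. by rewrite (raddfB val u v : span_val (u - v) = _). Qed.

Lemma spanZ a u x : span_val (a *: u) x = a * span_val u x.
Proof. by rewrite (GRing.valZ a u : span_val (a *: u) = _). Qed.

Lemma span_ext u v :
  (forall x, Xp x -> span_val u x = span_val v x) -> u = v.
Proof. by move=> uv; apply: val_inj; exact: dual_ext. Qed.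

Lemma span_leP u v :
  span_cone Xp' (v - u) <-> forall x, Xp x -> span_val u x <= span_val v x.
Proof.
by split=> uv x Xx; have := uv x Xx; rewrite spanB subr_ge0.
Qed.

Lemma span_decomposition u : exists f g,
  [/\ Xp' f, Xp' g & span_val u = f - g].
Proof.
have /span_predP := valP u; rewrite cone_smallest_subspace//.
exact: dual_cone_is_cone.
Qed.

(** [f] is the difference of the positive functionals [g] and [g - f]. Limits of functionals are
    placed in the span this way. *)
Lemma dominated_in_span f g :
  Xp' g -> Xp' (g - f) -> exists u : S, span_val u = f.
Proof.
move=> g0 gf; suff fS : f \in span_pred Xp' by exists (Span fS).
apply/span_predP; rewrite cone_smallest_subspace; last exact: dual_cone_is_cone.
by exists g, (g - f); split => //; rewrite opprB addrC subrK.
Qed.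

Lemma span_upper_bound u v : exists f, [/\ Xp' f,
  forall x, Xp x -> span_val u x <= f x &
  forall x, Xp x -> span_val v x <= f x].
Proof.
have [f [g [f0 g0 ->]]] := span_decomposition u.
have [f' [g' [f'0 g'0 ->]]] := span_decomposition v.
exists (f + f'); split => x Xx; rewrite ?bopBE bopDE;
  have := f0 x Xx; have := g0 x Xx; have := f'0 x Xx; have := g'0 x Xx;
  by move=> *; lra.
Qed.

Lemma span_cone_is_cone : is_cone (span_cone Xp').
Proof.
split; first by exists 0.
  move=> a b u v a0 b0 u0 v0 x Xx; rewrite spanD !spanZ.
  by apply: addr_ge0; apply: mulr_ge0; [|exact: u0| |exact: v0].
apply/seteqP; split => [u [u0 Nu0]|_ ->]; last first.
  by split=> x Xx; rewrite ?oppr0.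
apply: span_ext => x Xx; apply/eqP; rewrite eq_le u0// andbT.
by have := Nu0 x Xx; rewrite -[- u]sub0r spanB sub0r oppr_ge0.
Qed.

Lemma cone_pointwise_bounded (A : Type) (g : A -> dual X) :
  (forall x, Xp x -> exists M, forall i, `|g i x| <= M) ->
  forall x, exists M, forall i, `|g i x| <= M.
Proof.
move=> gb x; have [y [z [Xy Xz ->]]] := genX x.
have [M gM] := gb y Xy; have [M' gM'] := gb z Xz; exists (M + M') => i.
by rewrite linearB/=; apply: (le_trans (ler_normB _ _)); exact: lerD.
Qed.

(** The functionals with [|f x| <= |x|] on the cone are pointwise bounded, since the cone generates,
    hence uniformly bounded; the general case follows by scaling. It replaces a norm-controlled
    decomposition of the vectors of [X]. *)
Lemma cone_norm_bound : exists2 K : R, 0 < K & forall f M, 0 <= M ->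
  (forall x, Xp x -> `|f x| <= M * `|x|) -> forall x, `|f x| <= K * M * `|x|.
Proof.
pose A := {f : dual X | forall x, Xp x -> `|f x| <= `|x|}.
have [K0 fK] : exists K, forall (i : A) x, `|sval i x| <= K * `|x|.
  apply: pointwise_bounded_dual; apply: cone_pointwise_bounded => x Xx.
  by exists `|x| => -[f] /=; exact.
exists (`|K0| + 1) => [|f M]; first by apply: ltr_pwDr.
rewrite le_eqVlt => /predU1P[<-|M0] fM x.
  (* Scaling by [M^-1] is impossible for [M = 0], but then [f] vanishes on the cone. *)
  suff -> : f = 0 by rewrite mulr0 mul0r normr0.
  apply: dual_ext => y Xy; apply/eqP; rewrite -normr_le0.
  by have := fM y Xy; rewrite mul0r.
have fA y : Xp y -> `|(M^-1 *: f) y| <= `|y|.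
  move=> Xy; rewrite bopZE normrZ normfV (gtr0_norm M0) ler_pdivrMl//.
  exact: fM.
have : `|(M^-1 *: f) x| <= K0 * `|x| := fK (exist _ _ fA) x.
rewrite bopZE normrZ normfV (gtr0_norm M0) ler_pdivrMl// => /le_trans; apply.
rewrite mulrA ler_wpM2r// mulrC ler_wpM2r ?(ltW M0)//.
by apply: (le_trans (ler_norm _)); rewrite lerDl.
Qed.

End dual_of_generating_cone.

(** The tails of a directed set form a filter base; [U] is any ultrafilter refining it. *)
Lemma directed_ultrafilter (A : Type) (le : A -> A -> Prop) : directed le ->
  exists U : set_system A, UltraFilter U /\ forall i, U [set j | le i j].
Proof.
case=> [[i0 _] refl_le tr ub].
have FF : ProperFilter (filter_from setT (fun i => [set j | le i j])).
  apply: filter_from_proper => [|i _]; last by exists i; exact: refl_le.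
  apply: filter_fromT_filter; first by exists i0.
  move=> i j; have [k ik jk] := ub i j; exists k => l kl.
  by split; [exact: tr kl|exact: tr kl].
have [U [UU FU]] := ultraFilterLemma FF.
by exists U; split => // i; apply: FU; exists i.
Qed.

(** * The lattice norm on the span, its completeness, and increasing nets *)

Section order_norm.
Context {R : realType} {X : completeNormedModType R} {Xp : set X}.
Hypothesis genX : generating Xp.
Local Notation Xp' := (dual_cone Xp).
Local Notation S := (span_of Xp').
Hypothesis lS : vector_lattice (span_cone Xp').
Implicit Types (f g h : dual X) (u v w : S) (x y z : X).

Definition dominated u (M : R) : Prop := 0 <= M /\
  exists h, forall x, Xp x -> `|span_val u x| <= h x /\ h x <= M * `|x|.

(* Equals the supremum of the modulus of [u] over the positive elements of the
   unit ball. *)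
Definition order_norm u : R := inf [set M | dominated u M].

Let aS u : S := modulus (span_cone Xp') u.

Lemma span_norm_le_modulus u x : Xp x -> `|span_val u x| <= span_val (aS u) x.
Proof.
move=> Xx; have [au aNu] := modulus_ge lS u.
rewrite ler_norml; move/span_leP/(_ x Xx): au => ->.
by have := aNu x Xx; rewrite spanD andbT lerNl; lra.
Qed.

(** [h] is positive, so it lies in the span and competes as an upper bound of [u] and [- u]. *)
Lemma modulus_le_bound u h :
  (forall x, Xp x -> `|span_val u x| <= h x) ->
  forall x, Xp x -> span_val (aS u) x <= h x.
Proof.
move=> uh x Xx.
have [||v vh] := @dominated_in_span _ _ _ genX h h.
- by move=> y Xy; exact: le_trans (normr_ge0 _) (uh y Xy).
- by move=> y Xy; rewrite subrr.
rewrite -vh; suff /span_leP/(_ x Xx) : span_cone Xp' (v - aS u) by [].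
apply: (modulus_le lS) => y Xy.
- by have := uh y Xy; rewrite -vh spanB ler_norml subr_ge0 => /andP[].
- by have := uh y Xy; rewrite -vh spanD ler_norml => /andP[? ?]; lra.
Qed.

Lemma order_norm_le u M : dominated u M -> order_norm u <= M.
Proof. by move=> uM; apply: ge_inf => //; exists 0 => ? []. Qed.

Lemma dominated_modulus u :
  dominated u (op_norm (span_val (aS u))).
Proof.
split; first exact: op_norm_ge0.
exists (span_val (aS u)) => x Xx; split; first exact: span_norm_le_modulus.
exact: le_trans (ler_norm _) (op_norm_bound _ _).
Qed.

(** The infimum is attained because the modulus lies below every admissible [h] and so serves all
    values [M] at once. *)
Lemma order_norm_dominated u : dominated u (order_norm u).
Proof.
have ne : [set M | dominated u M] !=set0.
  by eexists; exact: dominated_modulus.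
split; first by apply: lb_le_inf => // ? [].
exists (span_val (aS u)) => x Xx; split; first exact: span_norm_le_modulus.
have [->|x0] := eqVneq x 0; first by rewrite linear0 normr0 mulr0.
rewrite -ler_pdivrMr ?normr_gt0//; apply: lb_le_inf => // M [M0 [h hP]].
rewrite ler_pdivrMr ?normr_gt0//; have [_] := hP x Xx; apply: le_trans.
by apply: modulus_le_bound => // y /hP[].
Qed.

Lemma order_norm_ge0 u : 0 <= order_norm u.
Proof. by case: (order_norm_dominated u). Qed.

Lemma order_norm_bound u x : Xp x -> `|span_val u x| <= order_norm u * `|x|.
Proof.
move=> Xx; have [_ [h /(_ x Xx)[]]] := order_norm_dominated u.
exact: le_trans.
Qed.

Lemma order_norm_le_positive u M : 0 <= M -> Xp' (span_val u) ->
  (forall x, Xp x -> span_val u x <= M * `|x|) -> order_norm u <= M.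
Proof.
move=> M0 u0 uM; apply: order_norm_le; split => //; exists (span_val u) => x Xx.
by rewrite ger0_norm ?u0//; split => //; exact: uM.
Qed.

Lemma order_norm_is_norm : is_norm order_norm.
Proof.
split.
- move=> u v; have [u0 [h hP]] := order_norm_dominated u.
  have [v0 [k kP]] := order_norm_dominated v.
  apply: order_norm_le; split; first exact: addr_ge0.
  exists (h + k) => x Xx; have [uh hu] := hP x Xx; have [vk kv] := kP x Xx.
  rewrite spanD bopDE mulrDl; split; last exact: lerD.
  by apply: (le_trans (ler_normD _ _)); exact: lerD.
- have le (a : R) u : order_norm (a *: u) <= `|a| * order_norm u.
    have [u0 [h hP]] := order_norm_dominated u.
    apply: order_norm_le; split; first exact: mulr_ge0.
    exists (`|a| *: h) => x Xx; have [uh hu] := hP x Xx.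
    by rewrite spanZ bopZE normrM -mulrA; split; exact: ler_wpM2l.
  move=> a u; apply/eqP; rewrite eq_le le/=.
  have [->|a0] := eqVneq a 0; first by rewrite normr0 mul0r order_norm_ge0.
  rewrite -ler_pdivlMl ?normr_gt0// -normfV.
  by rewrite -{1}(scale1r u) -(mulVf a0) -scalerA; exact: le.
- move=> u u0; apply: (span_ext genX) => x Xx; apply/eqP; rewrite -normr_le0.
  by have := order_norm_bound u Xx; rewrite u0 mul0r.
Qed.

(** Let [f] be the limit of [u n] along an ultrafilter. For fixed large [m], the moduli of
    [u m - u n] have a limit [h] in [n], which dominates [u m - f] and is at most [e] times the norm
    on the cone. *)
Lemma order_norm_cauchy_complete : norm_cauchy_complete order_norm.
Proof.
move=> u cu; have [K K0 KP] := cone_norm_bound genX.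
have [U [UU UN]] := @ultraFilterLemma _ (nbhs \oo) _.
have UE n0 : U [set n | (n0 <= n)%N] by apply: UN; exists n0.
have [f fP] : exists f : dual X, forall x, span_val (u n) x @[n --> U] --> f x.
  have [n0 n0P] := cu 1 ltr01.
  apply: (@bounded_ultralimit _ _ _ _ _ _ (K * (order_norm (u n0) + 1))).
  apply: filterS (UE n0) => n n0n; apply: KP => [|x Xx].
    by rewrite addr_ge0// order_norm_ge0.
  rewrite -[u n](subrK (u n0)) spanD addrC mulrDl mul1r.
  apply: (le_trans (ler_normD _ _)); apply: lerD; first exact: order_norm_bound.
  apply: (le_trans (order_norm_bound _ Xx)); rewrite ler_piMl//.
  by apply/ltW/n0P.
have dom e : 0 < e -> exists n1, forall m, (n1 <= m)%N ->
    exists h, forall x, Xp x -> `|span_val (u m) x - f x| <= h x /\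
      h x <= e * `|x|.
  move=> e0; have [n1 n1P] := cu e e0; exists n1 => m n1m.
  have aP n x : (n1 <= n)%N -> Xp x -> span_val (aS (u m - u n)) x <= e * `|x|.
    move=> n1n Xx; have [_ [h hP]] := order_norm_dominated (u m - u n).
    have /le_trans -> // : span_val (aS (u m - u n)) x <= h x.
      by apply: modulus_le_bound => // y /hP[].
    have [_ /le_trans] := hP x Xx; apply.
    by rewrite ler_wpM2r// ltW// n1P.
  have [|h hP] := @bounded_ultralimit R X _ U _
      (fun n => span_val (aS (u m - u n))) (K * e).
    apply: filterS (UE n1) => n n1n; apply: KP => [|x Xx]; first exact: ltW.
    rewrite ger0_norm; first exact: aP.
    exact: le_trans (normr_ge0 _) (span_norm_le_modulus _ Xx).
  exists h => x Xx; split; last first.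
    by apply: (cvgr_to_le (hP x)); apply: filterS (UE n1) => n n1n; exact: aP.
  apply: (le_limit _ (hP x)).
    by apply: cvg_norm; apply: cvgB (fP x); exact: cvg_cst.
  by apply: nearW => n; exact: (span_norm_le_modulus (u m - u n) Xx).
(* [f] is dominated by the modulus of [u n1] plus the majorant [h] of [u n1 - f]. *)
have [l lE] : exists l : S, span_val l = f.
  have [n1 /(_ n1 (leqnn _))[h hP]] := dom 1 ltr01.
  apply: (@dominated_in_span _ _ _ genX _ (span_val (aS (u n1)) + h)) => x Xx.
    rewrite bopDE; have [/(le_trans (normr_ge0 _)) h0 _] := hP x Xx.
    apply: addr_ge0 => //.
    exact: le_trans (normr_ge0 _) (span_norm_le_modulus _ Xx).
  have [+ _] := hP x Xx; have := span_norm_le_modulus (u n1) Xx.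
  rewrite bopBE bopDE !ler_norml => /andP[_ ?] /andP[? ?]; lra.
exists l => e e0; have e20 : 0 < e / 2 by rewrite divr_gt0.
have [n1 n1P] := dom _ e20; exists n1 => n /n1P[h hP].
apply: (@le_lt_trans _ _ (e / 2)); last by lra.
apply: order_norm_le; split; first exact: ltW.
by exists h => x Xx; rewrite spanB lE; exact: hP.
Qed.

Lemma order_norm_closed : norm_closed order_norm (span_cone Xp').
Proof.
move=> u uC x Xx; apply/ler_addgt0Pr => e e0.
(* The summand 1 avoids a division by zero at [x = 0]. *)
have d0 : 0 < `|x| + 1 by rewrite ltr_wpDl.
have [|v v0 uv] := uC (e / (`|x| + 1)); first by rewrite divr_gt0.
have := order_norm_bound (u - v) Xx; rewrite spanB ler_norml => /andP[+ _].
have : order_norm (u - v) * `|x| <= e.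
  apply: (@le_trans _ _ (e / (`|x| + 1) * `|x|)).
    by rewrite ler_wpM2r// ltW.
  by rewrite mulrAC ler_pdivrMr// ler_wpM2l ?(ltW e0)// lerDl.
by have := v0 x Xx => ? ? ?; lra.
Qed.

Lemma order_norm_banach_lattice : banach_lattice order_norm (span_cone Xp').
Proof.
split => //.
  split; [exact: order_norm_is_norm|exact: order_norm_cauchy_complete| |].
    exact: span_cone_is_cone.
  exact: order_norm_closed.
move=> u v /span_leP uv; have [v0 [h hP]] := order_norm_dominated v.
apply: order_norm_le; split => //; exists h => x Xx.
split; last by have [] := hP x Xx.
apply: (le_trans (span_norm_le_modulus u Xx)); apply: (le_trans (uv x Xx)).
by apply: modulus_le_bound => // y /hP[].
Qed.

(** If [h] dominates [u], then [u] is the difference of the positive functionals [(h + u) / 2] and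
    [(h - u) / 2], each of norm at most [K * order_norm u]. Conversely, [u = f - g] with [f], [g]
    positive is dominated by [f + g]. *)
Lemma order_norm_equivalent : equivalent_norms (span_norm Xp') order_norm.
Proof.
have halves (a b : R) : b = 2^-1 * (a + 1 * b) - 2^-1 * (a + -1 * b) by lra.
have [K K0 KP] := cone_norm_bound genX.
exists (2 * K)^-1, 1; split => // [|u]; first by rewrite invr_gt0 mulr_gt0.
apply/andP; split.
  rewrite ler_pdivrMl ?mulr_gt0//.
  have [u0 [h hP]] := order_norm_dominated u.
  pose hu (s : R) : dual X := 2^-1 *: (h + s *: span_val u).
  have huE s x : hu s x = 2^-1 * (h x + s * span_val u x) by [].
  have half (s : R) : `|s| = 1 ->
      Xp' (hu s) /\ `|hu s| <= K * order_norm u.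
    move=> s1.
    have hb x : Xp x -> 0 <= hu s x <= order_norm u * `|x|.
      move=> Xx; have [uh hM] := hP x Xx; rewrite huE.
      have : `|s * span_val u x| <= h x by rewrite normrM s1 mul1r.
      by rewrite ler_norml => /andP[? ?]; apply/andP; split; lra.
    split=> [x /hb/andP[]//|]; apply: op_norm_le => x x1.
    apply: (@le_trans _ _ (K * order_norm u * `|x|)).
      apply: KP => // y /hb/andP[? ?]; by rewrite ger0_norm.
    by rewrite ler_piMr// mulr_ge0// ltW.
  have [|p1 n1] := half 1; first by rewrite normr1.
  have [|p2 n2] := half (-1); first by rewrite normrN1.
  rewrite -mulrA mulr_natl mulr2n; apply: le_trans (lerD n1 n2).
  apply: ge_inf; first by exists 0 => _ [y [z [_ _ _ ->]]]; rewrite addr_ge0.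
  exists (hu 1), (hu (-1)); split => //; apply: bop_ext => x.
  by rewrite bopBE !huE -halves.
rewrite mul1r; apply: lb_le_inf.
  have [f [g [f0 g0 ufg]]] := span_decomposition genX u.
  by exists (`|f| + `|g|), f, g.
move=> _ [f [g [f0 g0 ufg ->]]]; apply: order_norm_le.
split; first by rewrite addr_ge0.
exists (f + g) => x Xx; rewrite ufg bopBE bopDE; split.
  have := f0 x Xx; have := g0 x Xx => ? ?.
  by rewrite ler_norml; apply/andP; split; lra.
rewrite mulrDl; apply: lerD;
  exact: le_trans (ler_norm _) (op_norm_bound _ _).
Qed.

(** The limit along an ultrafilter containing all tails is an upper bound by monotonicity and is
    approached at each point. Both order suprema and norm limits are derived from this. *)
Lemma increasing_net_limit (A : Type) (le : A -> A -> Prop) (u : A -> S) :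
  increasing_net (span_cone Xp') le u -> norm_bounded order_norm u ->
  exists l : S, (forall i x, Xp x -> span_val (u i) x <= span_val l x) /\
    forall x e, 0 < e -> exists i, span_val l x - span_val (u i) x < e.
Proof.
move=> [dle iu] [M uM]; have [U [UU UE]] := directed_ultrafilter dle.
have [K K0 KP] := cone_norm_bound genX.
have {}iu i j x : le i j -> Xp x -> span_val (u i) x <= span_val (u j) x.
  by move=> ij; move: x; apply/span_leP/iu.
have [[i0 _] _ _ _] := dle.
have M0 : 0 <= M := le_trans (order_norm_ge0 _) (uM i0).
have [|f fP] := @bounded_ultralimit R X _ U _ (fun i => span_val (u i)) (K * M).
  apply: nearW => i; apply: KP => // x Xx.
  by apply: (le_trans (order_norm_bound _ Xx)); rewrite ler_wpM2r.
have uf i x : Xp x -> span_val (u i) x <= f x.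
  move=> Xx; apply: (cvgr_to_ge (fP x)); apply: filterS (UE i) => j ij.
  exact: iu.
have [l lE] : exists l : S, span_val l = f.
  pose a := span_val (aS (u i0)).
  (* Both [a] and [f - u i0] are positive on the cone, and this sum exceeds [f] by [a - u i0]. *)
  apply: (@dominated_in_span _ _ _ genX _ (a + (f - span_val (u i0)))) => x Xx;
    rewrite ?bopBE bopDE bopBE; have := span_norm_le_modulus (u i0) Xx;
    rewrite ler_norml => /andP[? ?]; have := uf i0 x Xx => ?; rewrite /a; lra.
exists l; split=> [i x Xx|x e e0]; first by rewrite lE; exact: uf.
have /cvgrPdist_lt/(_ e e0)/filter_ex[i] := fP x.
by rewrite lE ltr_norml => /andP[_ ?]; exists i.
Qed.

Lemma order_norm_monotonically_complete :
  monotonically_complete order_norm (span_cone Xp').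
Proof.
move=> A le u iu bu; have [l [ul lu]] := increasing_net_limit iu bu.
exists l; split=> [_ [i _ <-]|t ut]; apply/span_leP => x Xx; first exact: ul.
apply/ler_addgt0Pr => e e0; have [i lui] := lu x e e0.
have /span_leP/(_ x Xx) : cone_le (span_cone Xp') (u i) t.
  by apply: ut; exists i.
lra.
Qed.

(* A Dini-type argument: were the convergence not uniform on the positive part
   of the unit ball, the points [x i] witnessing this would have a weak cluster
   point by reflexivity, contradicting pointwise convergence there. *)
Lemma reflexive_net_converges (A : Type) (le : A -> A -> Prop) (u : A -> S) :
  is_cone Xp -> reflexive_space X ->
  increasing_net (span_cone Xp') le u -> norm_bounded order_norm u ->
  exists l : S, net_norm_converges order_norm le u l.
Proof.
move=> cX rX iu bu; have [l [ul lu]] := increasing_net_limit iu bu.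
case: iu => dle {}iu; exists l => e e0.
have {}iu i j x : le i j -> Xp x -> span_val (u i) x <= span_val (u j) x.
  by move=> ij; move: x; apply/span_leP/iu.
apply: contrapT => ncvg.
(* The witness can be taken for [u i] itself: [l - u j] lies below [l - u i] for [j] after [i]. The
   value [e / 2] leaves room for the strict inequality. *)
have /choice[x xP] i : exists x, [/\ Xp x, `|x| <= 1 &
    e / 2 <= span_val l x - span_val (u i) x].
  apply: contrapT => nx; apply: ncvg; exists i => j ij.
  apply: (@le_lt_trans _ _ (e / 2)); last by lra.
  have -> : order_norm (u j - l) = order_norm (l - u j).
    have [_ NZ _] := order_norm_is_norm.
    by rewrite -[u j - l]opprB -scaleN1r NZ normrN1 mul1r.
  apply: order_norm_le_positive; first by rewrite divr_ge0// ltW.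
    by move=> x Xx; have := ul j x Xx; rewrite spanB subr_ge0.
  move=> x Xx; have [->|x0] := eqVneq x 0.
    by rewrite linear0 normr0 mulr0.
  have nx0 : 0 < `|x| by rewrite normr_gt0.
  have uijx := iu i j x ij Xx.
  rewrite spanB; apply: (@le_trans _ _ (span_val l x - span_val (u i) x)).
    by lra.
  rewrite -ler_pdivrMr// leNgt; apply/negP => lt; apply: nx.
  exists (`|x|^-1 *: x); split.
  - by apply: coneZ; rewrite ?invr_ge0.
  - by rewrite normrZ normfV normr_id mulVf// gt_eqF.
  - have sE (f : dual X) : f (`|x|^-1 *: x) = f x / `|x|.
      by rewrite linearZ mulrC.
    by rewrite !sE -mulrBl ltW.
have [U [UU UE]] := directed_ultrafilter dle.
have ev_lin i : linear (fun f : dual X => f (x i)) by [].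
have evP i (f : dual X) : `|f (x i)| <= 1 * `|f|.
  by rewrite mul1r; apply: op_norm_ub; have [] := xP i.
have /choice[ev evE] i : exists g : dual (dual X), forall f, g f = f (x i).
  exact: bounded_linear_bop (ev_lin i) (evP i).
have [|phi phiP] := @bounded_ultralimit R (dual X) _ U _ ev 1.
  by apply: nearW => i f; rewrite evE.
(* No positivity of [y] is required: [l - u j] is small at [y1], and subtracting its nonnegative
   value at [y2] only lowers the result. *)
have [y yP] := rX phi; have [y1 [y2 [Xy1 Xy2 yE]]] := genX y.
have [j luj] := lu y1 (e / 2) ltac:(lra).
(* For [i] after [j], [l - u j] at [x i] is at least [l - u i] at [x i], hence at least [e / 2]. *)
have : e / 2 <= phi (span_val l - span_val (u j)).
  apply: (cvgr_to_ge (phiP _)); apply: filterS (UE j) => i ji.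
  have [Xx _ ex] := xP i; have := iu _ _ _ ji Xx.
  by rewrite evE bopBE => ?; lra.
rewrite yP bopBE yE !linearB/=; have := ul j y2 Xy2 => ? ?; lra.
Qed.

End order_norm.

(** * Transfer of the lattice structure from the dual of [Z] *)

Section lattice_approximation.
Context {R : realType} {X Z : completeNormedModType R}.
Context {Xp : set X} {Zp : set Z}.
Hypothesis genX : generating Xp.
Hypothesis blZ : banach_lattice (@Num.norm R Z) Zp.
Variables (J : bop X Z) (Rn : nat -> bop Z X).
Hypothesis J_pos : positive_map Xp Zp J.
Hypothesis Rn_pos : forall n, positive_map Zp Xp (Rn n).
Hypothesis RnJ_cvg : wot_converges (fun n => bop_comp (Rn n) J) (bop_id X).
Local Notation Xp' := (dual_cone Xp).
Local Notation Zp' := (dual_cone Zp).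
Local Notation S := (span_of Xp').
Implicit Types (u v w : S).

Let coneZp : is_cone Zp. Proof. by case: blZ => _ []. Qed.
Let latticeZp : vector_lattice Zp. Proof. by case: blZ. Qed.

Let RnJ (f : dual X) x : f (Rn n (J x)) @[n --> \oo] --> f x.
Proof. exact: RnJ_cvg. Qed.

Lemma lattice_generating : generating Zp.
Proof.
move=> z; exists (modulus Zp z), (modulus Zp z - z); split.
- exact: modulus_ge0.
- by have [] := modulus_ge latticeZp z.
- by rewrite opprB addrC subrK.
Qed.

(** The choices [a = y] and [a = 0] give the upper bounds; an upper bound [t] satisfies
    [f a + g (y - a) <= t a + t (y - a) = t y]. *)
Lemma dual_sup_is_sup (f g s : dual Z) :
  (forall y, Zp y ->
    (forall a, Zp a -> Zp (y - a) -> f a + g (y - a) <= s y) /\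
    (forall c, (forall a, Zp a -> Zp (y - a) -> f a + g (y - a) <= c) ->
      s y <= c)) ->
  is_sup Zp' [set f; g] s.
Proof.
move=> sP; apply: sup_pairP => [y Zy|y Zy|t tf tg y Zy]; rewrite bopBE subr_ge0.
- have := (sP y Zy).1 y Zy; rewrite subrr linear0 addr0; apply; exact: cone0.
- have := (sP y Zy).1 0 (cone0 coneZp); rewrite subr0 linear0 add0r; exact.
- apply: (sP y Zy).2 => a Za Zya.
  have := tf a Za; have := tg _ Zya; rewrite !bopBE !linearB/= => ? ?; lra.
Qed.

Lemma span_sup u v : exists w, is_sup (span_cone Xp') [set u; v] w.
Proof.
have [t [t0 ut vt]] := span_upper_bound genX u v.
have /choice[s sP] n := dual_sup blZ (bop_comp (span_val u) (Rn n))
                                     (bop_comp (span_val v) (Rn n)).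
have s_ub n x : Xp x -> span_val u (Rn n (J x)) <= s n (J x) /\
    span_val v (Rn n (J x)) <= s n (J x).
  move=> Xx; have [su sv] := sup_pair_ub (dual_sup_is_sup (sP n)).
  by have := su _ (J_pos Xx); have := sv _ (J_pos Xx); rewrite !bopBE !subr_ge0.
(* Positivity of [Rn n] makes [w] composed with [Rn n] an upper bound in the dual of [Z]. *)
have s_le n (w : dual X) x : (forall y, Xp y -> span_val u y <= w y) ->
    (forall y, Xp y -> span_val v y <= w y) -> Xp x ->
    s n (J x) <= w (Rn n (J x)).
  move=> uw vw Xx; have := sup_pair_least (dual_sup_is_sup (sP n))
    (t := bop_comp w (Rn n)).
  move=> H; rewrite -subr_ge0; apply: H (J_pos Xx) => y Zy;
    rewrite bopBE subr_ge0; [exact/uw/Rn_pos|exact/vw/Rn_pos].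
have [U [UU UN]] := @ultraFilterLemma _ (nbhs \oo) _.
have [|m mP] := @pointwise_bounded_ultralimit R X _ U _
    (fun n => bop_comp (s n) J).
  (* On the cone, [s n (J x)] lies between two convergent, hence bounded, sequences. *)
  apply: (cone_pointwise_bounded genX) => x Xx.
  have [M1 M1P] := cvg_seq_norm_bounded (@RnJ (span_val u) x).
  have [M2 M2P] := cvg_seq_norm_bounded (@RnJ t x).
  exists (M1 + M2) => n; have := M1P n; have := M2P n.
  have [+ _] := s_ub n x Xx; have := s_le n t x ut vt Xx; rewrite /= !ler_norml.
  by move=> ? ? /andP[? ?] /andP[? ?]; lra.
have RnJU (f : dual X) x : f (Rn n (J x)) @[n --> U] --> f x.
  by apply: cvg_trans (@RnJ f x) => B; exact: UN.
have um x : Xp x -> span_val u x <= m x /\ span_val v x <= m x.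
  move=> Xx; split; apply: (le_limit (RnJU _ x) (mP x)); apply: nearW => n;
  by have [] := s_ub n x Xx.
have mle (w : dual X) : (forall y, Xp y -> span_val u y <= w y) ->
    (forall y, Xp y -> span_val v y <= w y) -> forall x, Xp x -> m x <= w x.
  move=> uw vw x Xx; apply: (le_limit (mP x) (RnJU _ x)); apply: nearW => n.
  exact: s_le.
have [||w wE] := @dominated_in_span _ _ _ genX m t => //.
  by move=> x Xx; rewrite bopBE subr_ge0; exact: mle.
exists w; apply: sup_pairP => [||r ur vr]; apply/span_leP => x Xx; rewrite wE.
- by have [] := um x Xx.
- by have [] := um x Xx.
- by apply: mle => // y Xy; [move/span_leP: ur|move/span_leP: vr]; exact.
Qed.

Lemma span_vector_lattice : vector_lattice (span_cone Xp').
Proof. by split; [exact: span_cone_is_cone|exact: span_sup]. Qed.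

Lemma dual_lattice_bound (f : dual Z) : exists h : dual Z,
  forall z, Zp z -> `|f z| <= h z.
Proof.
have [h hP] := dual_sup blZ f (- f); exists h => z Zz.
have [fh gh] := sup_pair_ub (dual_sup_is_sup hP).
have := fh z Zz; have := gh z Zz; rewrite !bopBE bopNE ler_norml => ? ?.
by apply/andP; split; lra.
Qed.

Lemma adjoint_in_span (f : dual Z) : exists u, span_val u = adjoint J f.
Proof.
have [h hP] := dual_lattice_bound f.
apply: (@dominated_in_span _ _ _ genX _ (adjoint J h)) => x Xx;
  have := hP _ (J_pos Xx); rewrite ?bopBE ler_norml /= => /andP[? ?]; lra.
Qed.

Variable J' : dual Z -> S.
Hypothesis J'E : forall f, span_val (J' f) = adjoint J f.

Let J'x f x : span_val (J' f) x = f (J x).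
Proof. by rewrite J'E. Qed.

Lemma adjoint_span_linear : linear J'.
Proof.
by move=> a f g; apply: (span_ext genX) => x Xx; rewrite spanD spanZ !J'x.
Qed.

(** Let [t] be an upper bound of [J' f] and [J' g]. For [a] between 0 and [J x], [f a + g (J x - a)]
    is the limit of the same expression with [J] after [Rn n] inserted, which is at most
    [t (Rn n (J x))] and so at most [t x] in the limit. The Riesz-Kantorovich formula then gives
    [s (J x) <= t x]. *)
Lemma adjoint_lattice_homomorphism :
  wot_converges (fun n => bop_comp J (Rn n)) (bop_id Z) ->
  lattice_homomorphism Zp' (span_cone Xp') J'.
Proof.
move=> JRn_cvg; split=> [|f g s ss]; first exact: adjoint_span_linear.
have [s' s'P] := dual_sup blZ f g.
(* Uniqueness of suprema transfers the formula to the given [s]. *)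
have {s' s'P} sP : forall y c, Zp y ->
    (forall a, Zp a -> Zp (y - a) -> f a + g (y - a) <= c) -> s y <= c.
  move=> y c Zy; have -> : s = s'; last exact: (s'P y Zy).2.
  apply: is_sup_unique ss (dual_sup_is_sup s'P).
  exact: dual_cone_is_cone lattice_generating.
have [fs gs] := sup_pair_ub ss.
apply: sup_pairP => [||t ft gt]; apply/span_leP => x Xx; rewrite !J'x.
- by have := fs _ (J_pos Xx); rewrite bopBE subr_ge0.
- by have := gs _ (J_pos Xx); rewrite bopBE subr_ge0.
apply: sP (J_pos Xx) _ => a Za Zb.
apply: (le_limit _ (@RnJ (span_val t) x)).
  exact: cvgD (JRn_cvg a f) (JRn_cvg (J x - a) g).
apply: nearW => n /=.
have -> : span_val t (Rn n (J x))
    = span_val t (Rn n a) + span_val t (Rn n (J x - a)).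
  by rewrite !linearB/= addrC subrK.
have := (span_leP _ _).1 ft _ (Rn_pos n Za).
have := (span_leP _ _).1 gt _ (Rn_pos n Zb).
by rewrite !J'x => ? ?; exact: lerD.
Qed.

Lemma adjoint_lattice_ideal :
  wot_converges (fun n => bop_comp J (Rn n)) (bop_id Z) ->
  lattice_ideal (span_cone Xp') (range J').
Proof.
move=> JRn_cvg; split.
  split; first by exists 0 => //; apply: (span_ext genX) => x Xx; rewrite J'x.
  by move=> a _ _ [f _ <-] [g _ <-]; exists (a *: f + g) => //;
    exact: adjoint_span_linear.
move=> u v uv [f _ fv]; move: uv; rewrite -fv => /span_leP uf.
have [h hP] := dual_lattice_bound f.
have lS := span_vector_lattice.
have uh x : Xp x -> `|span_val u x| <= h (J x).
  move=> Xx; apply: (le_trans (span_norm_le_modulus lS u Xx)).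
  apply: (le_trans (uf x Xx)).
  apply: (@modulus_le_bound _ _ _ genX lS _ (adjoint J h)) => // y Xy.
  by rewrite J'x; exact/hP/J_pos.
have [U [UU UN]] := @ultraFilterLemma _ (nbhs \oo) _.
have [|k kP] := @pointwise_bounded_ultralimit R Z _ U _
    (fun n => bop_comp (span_val u) (Rn n)).
  apply: (cone_pointwise_bounded lattice_generating) => z Zz.
  (* The values [u (Rn n z)] are bounded by [h (J (Rn n z))], which converges to [h z]. *)
  have [M MP] := cvg_seq_norm_bounded (@JRn_cvg z h).
  exists M => n; apply: (le_trans (uh _ (Rn_pos n Zz))).
  exact: le_trans (ler_norm _) (MP n).
exists k => //; apply: (span_ext genX) => x Xx; rewrite J'x.
(* Along [U], [u (Rn n (J x))] tends both to [k (J x)] and to [u x]. *)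
apply: (@cvg_unique _ (@Rhausdorff R)) (kP (J x)) _.
by apply: cvg_trans (@RnJ (span_val u) x) => B; exact: UN.
Qed.

End lattice_approximation.

Theorem theorem2p1 (R : realType) (X Z : completeNormedModType R)
    (Xp : set X) (Zp : set Z)
    (X_obs : ordered_banach_space (@Num.norm R X) Xp)
    (X_gen : generating Xp)
    (Z_bl : banach_lattice (@Num.norm R Z) Zp)
    (J : bop X Z) (J_pos : positive_map Xp Zp J)
    (Rn : nat -> bop Z X) (Rn_pos : forall n, positive_map Zp Xp (Rn n))
    (RnJ_cvg : wot_converges (fun n => bop_comp (Rn n) J) (bop_id X)) :
  let Xp' := dual_cone Xp in
  let Zp' := dual_cone Zp in
  [/\ (* (a) *)
      smallest linear_subspace Xp'
        = [set f | exists g h, [/\ Xp' g, Xp' h & f = g - h]] /\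
      exists N : span_of Xp' -> R,
        [/\ equivalent_norms (span_norm Xp') N,
            banach_lattice N (span_cone Xp')
          & monotonically_complete N (span_cone Xp')],
      (* (b) *)
      reflexive_space X ->
        forall N : span_of Xp' -> R,
          equivalent_norms (span_norm Xp') N ->
          banach_lattice N (span_cone Xp') ->
          KB_space N (span_cone Xp')
    & (* (c) *)
      wot_converges (fun n => bop_comp J (Rn n)) (bop_id Z) ->
        exists J' : dual Z -> span_of Xp',
          [/\ forall f, span_val (J' f) = adjoint J f,
              lattice_homomorphism Zp' (span_cone Xp') J'
            & lattice_ideal (span_cone Xp') (range J')] ].
Proof.
move=> Xp' Zp'; have [_ _ coneXp _] := X_obs.
have lS := span_vector_lattice X_gen Z_bl J_pos Rn_pos RnJ_cvg.
split.
- split; first exact: cone_smallest_subspace (dual_cone_is_cone X_gen).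
  exists order_norm; split.
  + exact: order_norm_equivalent.
  + exact: order_norm_banach_lattice.
  + exact: order_norm_monotonically_complete.
- move=> rX N [c [d [c0 d0 cNd]]] bl; split => // A le u iu [M uM].
  (* [N] and [order_norm] are compared through the span norm, so boundedness and convergence of the
     net carry over between them. *)
  have [a [b [a0 b0 aob]]] := order_norm_equivalent X_gen lS.
  have oN v : order_norm v <= b / c * N v.
    have /andP[cN _] := cNd v; have /andP[_ ob] := aob v.
    by apply: (le_trans ob); rewrite -mulrA ler_pM2l// ler_pdivlMl.
  have No v : N v <= d / a * order_norm v.
    have /andP[_ Nd] := cNd v; have /andP[ao _] := aob v.
    by apply: (le_trans Nd); rewrite -mulrA ler_pM2l// ler_pdivlMl.
  have [|l ul] := reflexive_net_converges X_gen lS coneXp rX iu.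
    exists (b / c * M) => i; apply: (le_trans (oN _)).
    by rewrite ler_pM2l// divr_gt0.
  exists l => e e0; have da : 0 < d / a by rewrite divr_gt0.
  have [|i0 i0P] := ul (e / (d / a)); first by rewrite divr_gt0.
  exists i0 => i /i0P; rewrite ltr_pdivlMr// mulrC.
  exact: le_lt_trans (No _).
- move=> JRn_cvg.
  have [J' J'E] := choice (adjoint_in_span X_gen Z_bl J_pos).
  exists J'; split => //.
  + exact: (adjoint_lattice_homomorphism X_gen Z_bl J_pos Rn_pos RnJ_cvg).
  + exact: (adjoint_lattice_ideal X_gen Z_bl J_pos Rn_pos RnJ_cvg).
Qed.
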